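(* Let $d$ be a positive integer, and for each integer $n \ge 0$ let $p_d(n) = 0^d + 1^d + 2^d + \cdots + n^d$. Then $p_d(n)$ is a polynomial in $n$ of degree $d+1$ with leading coefficient $\frac{1}{d+1}$ and constant term $0$; that is, there is a polynomial $P \in \mathbb{R}[X]$ of degree $d+1$, with leading coefficient $\frac{1}{d+1}$ and constant term $0$, such that $p_d(n) = P(n)$ for all integers $n \ge 0$. *)

(* Defs.v *)
From mathcomp Require Import all_boot all_order all_algebra.
From mathcomp Require Import reals.

Set Implicit Arguments.
Unset Strict Implicit.
Unset Printing Implicit Defensive.

Definition power_sum (d n : nat) : nat := \sum_(0 <= k < n.+1) k ^ d.

(* Main.v *)
Require Import Defs.
From mathcomp Require Import all_boot all_order all_algebra.
From mathcomp Require Import reals.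

(** The idea is discrete integration.  The forward difference of 'X^(d+1) is a
    polynomial of degree d with leading coefficient d+1, just like the
    derivative; so subtracting a suitable multiple of it from a polynomial Q of
    degree at most d cancels the top term of Q.  Repeating this writes Q as a
    forward difference, and telescoping then makes the partial sums
    Q(0) + ... + Q(n-1) a polynomial in n (lemma [poly_partial_sums]), whose
    top coefficient comes from the very first cancellation: it is Q`_d / (d+1).

    For Q = 'X^d this gives the sum of the k^d with k < n.  Adding the last
    term n^d changes neither the degree nor the leading coefficient, and it
    leaves the constant term 0 because d > 0. *)

Import Order.TTheory GRing.Theory Num.Theory.
Local Open Scope ring_scope.

Lemma coef_XD1_exp (R : comNzRingType) (d i : nat) :
  (('X + 1 : {poly R}) ^+ d)`_i = 'C(d, i)%:R.
Proof.
rewrite addrC exprDn coef_sum.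
under eq_bigr do rewrite expr1n mul1r coefMn coefXn.
have [lt_id|le_di] := ltnP i d.+1.
  rewrite (bigD1 (Ordinal lt_id)) //= eqxx big1 ?addr0 // => j ne_ji.
  by rewrite eq_sym -(inj_eq val_inj) /= in ne_ji; rewrite (negPf ne_ji) mul0rn.
rewrite bin_small // big1 // => j _.
by rewrite gtn_eqF ?mul0rn // (leq_trans (ltn_ord j)).
Qed.

Definition fwd_diff_Xn (R : comNzRingType) (d : nat) : {poly R} :=
  ('X + 1) ^+ d - 'X^d.

Lemma coef_fwd_diff_Xn_ge (R : comNzRingType) (d i : nat) :
  (d <= i)%N -> (fwd_diff_Xn R d)`_i = 0.
Proof.
rewrite coefB coef_XD1_exp coefXn leq_eqVlt => /predU1P[<-|lt_di].
  by rewrite binn eqxx subrr.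
by rewrite bin_small // gtn_eqF // subrr.
Qed.

Lemma coef_fwd_diff_Xn_top (R : comNzRingType) (d : nat) :
  (fwd_diff_Xn R d.+1)`_d = d.+1%:R.
Proof. by rewrite coefB coef_XD1_exp coefXn ltn_eqF // subr0 binSn. Qed.

Lemma sum_fwd_diff_Xn (R : comNzRingType) (d n : nat) :
  \sum_(0 <= k < n) (fwd_diff_Xn R d.+1).[k%:R] = n%:R ^+ d.+1.
Proof.
under eq_bigr do rewrite /fwd_diff_Xn !hornerE natr1.
by rewrite (telescope_sumr (fun k => k%:R ^+ d.+1)) // expr0n subr0.
Qed.

(** Summing over k < n, without the last term k = n, makes the empty sum the
    value at 0, so that the constant term vanishes for every Q, including
    constants.  The bound d is on the size rather than the degree of Q, so that
    the induction can start at Q = 0; there the top coefficient reads 0 / 0,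
    which is 0 by convention. *)
Lemma poly_partial_sums (R : numFieldType) (d : nat) (Q : {poly R}) :
  (size Q <= d)%N ->
  exists P : {poly R},
    [/\ (size P <= d.+1)%N,
        P`_0 = 0,
        P`_d = Q`_d.-1 / d%:R &
        forall n : nat, \sum_(0 <= k < n) Q.[k%:R] = P.[n%:R]].
Proof.
elim: d Q => [|d IHd] Q le_Qd.
  have -> : Q = 0 by apply/eqP; rewrite -size_poly_leq0.
  exists 0; rewrite size_poly0 !coef0 mul0r; split=> // n.
  by rewrite horner0 big1 // => k _; rewrite horner0.
pose c : R := Q`_d / d.+1%:R.
have [|P [le_Pd P0 _ sumP]] := IHd (Q - c *: fwd_diff_Xn R d.+1).
  apply/leq_sizeP => i; rewrite coefB coefZ leq_eqVlt => /predU1P[<-|lt_di].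
    by rewrite coef_fwd_diff_Xn_top divfK ?subrr // pnatr_eq0.
  by rewrite coef_fwd_diff_Xn_ge // mulr0 subr0 nth_default // (leq_trans le_Qd).
exists (c *: 'X^(d.+1) + P); split.
- rewrite (leq_trans (size_polyD _ _)) // geq_max (leqW le_Pd) andbT.
  by rewrite (leq_trans (size_scale_leq _ _)) // size_polyXn.
- by rewrite coefD coefZ coefXn mulr0 P0 addr0.
- by rewrite coefD coefZ coefXn eqxx mulr1 [P`__]nth_default // addr0.
- move=> n; rewrite hornerD hornerZ hornerXn -sumP -sum_fwd_diff_Xn mulr_sumr.
  rewrite -big_split; apply: eq_bigr => k _ /=.
  by rewrite hornerD hornerN hornerZ addrC subrK.
Qed.

Theorem theorem1p1 (R : realType) (d : nat) (hd : (0 < d)%N) :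
  exists P : {poly R},
    [/\ size P = d.+2,
        lead_coef P = 1 / d.+1%:R,
        P`_0 = 0 &
        forall n : nat, (power_sum d n)%:R = P.[n%:R]].
Proof.
have [|S [le_Sd S0 topS sumS]] := @poly_partial_sums R d.+1 'X^d.
  by rewrite size_polyXn.
have topP : (S + 'X^d)`_d.+1 = 1 / d.+1%:R.
  by rewrite coefD topS !coefXn eqxx gtn_eqF // addr0.
have sizeP : size (S + 'X^d) = d.+2.
  apply/eqP; rewrite eqn_leq (leq_trans (size_polyD _ _)) ?geq_max ?le_Sd /=;
    last by rewrite size_polyXn.
  (* The top coefficient is nonzero, so the size exceeds its index. *)
  rewrite ltnNge; apply/negP => /leq_sizeP/(_ _ (leqnn _))/eqP.
  by rewrite topP div1r invr_eq0 pnatr_eq0.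
exists (S + 'X^d); split=> //.
- by rewrite lead_coefE sizeP.
- by rewrite coefD S0 coefXn ltn_eqF // addr0.
- move=> n; rewrite /power_sum big_nat_recr //= natrD natr_sum hornerD hornerXn.
  rewrite -sumS natrX; congr (_ + _).
  by apply: eq_bigr => k _; rewrite hornerXn natrX.
Qed.
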